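(* Let $Y$ be a topological vector space, let $A$ be a closed proper subset of $Y$, and let $k\in Y\setminus\{0\}$ be such that $A-\mathbb{R}_{>}k\subseteq\operatorname{int}A$. Write $\varphi:=\varphi_{A,k}$. Then $$A=\operatorname{cl}(\operatorname{int}A),\qquad \operatorname{core}A=\operatorname{int}A,$$ $\varphi$ is continuous on $\operatorname{dom}\varphi$, the set $$\operatorname{dom}\varphi=\mathbb{R}k+A=\mathbb{R}k+\operatorname{int}A\neq\emptyset$$ is open, and for all $t\in\mathbb{R}$ $$\operatorname{lev}_{\varphi,\le}(t)=tk+A,\qquad\operatorname{lev}_{\varphi,<}(t)=tk+\operatorname{int}A,\qquad\operatorname{lev}_{\varphi,=}(t)=tk+\operatorname{bd}A.$$ Moreover: (a) For $y\in Y$: $\varphi(y)=-\infty\iff y+\mathbb{R}k\subseteq\operatorname{int}A$. (b) $\operatorname{bd}A+\mathbb{R}k$ is the subset of $Y$ on which $\varphi$ is finite-valued, and $\operatorname{dom}\varphi\setminus\operatorname{int}A\subseteq\operatorname{bd}A+\mathbb{R}_+k$. (c) The following four conditions are equivalent: $\varphi$ is proper; $\operatorname{int}A=\operatorname{bd}A-\mathbb{R}_{>}k$; $A=\operatorname{bd}A-\mathbb{R}_+k$; $\operatorname{dom}\varphi=\operatorname{bd}A+\mathbb{R}k$. (d) $\varphi$ is finite-valued if and only if $Y=\operatorname{bd}A+\mathbb{R}k$. (e) If $\varphi$ is proper, then: $\varphi$ is strictly quasiconvex $\iff$ $A$ is a strictly convex set. (f) If $\varphi$ is finite-valued, then: $\varphi$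 is linear $\iff$ $\operatorname{bd}A$ is a linear subspace of $Y$.
   Context: Vector spaces are real; $\mathbb{R}_+=\{t\in\mathbb{R}\mid t\ge0\}$, $\mathbb{R}_{>}=\{t\in\mathbb{R}\mid t>0\}$. ''Proper subset of $Y$'' means nonempty and different from $Y$. $\operatorname{core}$ is the algebraic interior; $\operatorname{int},\operatorname{cl},\operatorname{bd}$ the topological interior, closure, boundary. $\nu$ is a symbolic value not in $\overline{\mathbb{R}}=\mathbb{R}\cup\{\pm\infty\}$ and not comparable with any element of $\overline{\mathbb{R}}$; $\inf\emptyset:=\nu$. The function $\varphi_{A,k}:Y\to\overline{\mathbb{R}}\cup\{\nu\}$ is $\varphi_{A,k}(y)=\inf\{t\in\mathbb{R}\mid y\in tk+A\}$; $\operatorname{dom}\varphi_{A,k}=\{y\in Y\mid\varphi_{A,k}(y)\in\mathbb{R}\cup\{-\infty\}\}$. For $\mathcal{R}\in\{\le,<,=\}$, $\operatorname{lev}_{\varphi,\mathcal{R}}(t)=\{y\in Y\mid\varphi(y)\,\mathcal{R}\,t\}$ (never containing points with value $\nu$). $\varphi$ is proper if $\operatorname{dom}\varphi\ne\emptyset$ and it is real-valued on its domain; finite-valued if $\varphi(y)\in\mathbb{R}$ for all $y\in Y$ (finite-valued at a point: real value there). Continuity on $\operatorname{dom}\varphi$ refers to the restriction to $\operatorname{dom}\varphi$ as a map into $\overline{\mathbb{R}}$. $\varphi$ is strictly quasiconvex if $\operatorname{dom}\varphi$ is convex and $\varphi(\lambda y^1+(1-\lambda)y^2)<\max(\varphi(y^1),\varphi(y^2))$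 for all $y^1,y^2\in\operatorname{dom}\varphi$ with $y^1\neq y^2$ and all $\lambda\in(0,1)$. The closed set $A$ is strictly convex if $\lambda a^1+(1-\lambda)a^2\in\operatorname{int}A$ for all $a^1,a^2\in A$ with $a^1\neq a^2$ and all $\lambda\in(0,1)$. *)

(* Defs.v *)
From HB Require Import structures.
From mathcomp Require Import all_boot all_order all_algebra.
From mathcomp Require Import all_classical all_reals all_analysis.

Set Implicit Arguments.
Unset Strict Implicit.
Unset Printing Implicit Defensive.

Import Order.TTheory GRing.Theory Num.Theory.
Import numFieldNormedType.Exports.

Local Open Scope classical_set_scope.
Local Open Scope ring_scope.

Section MinkowskiOperations.
Context {R : realType} {Y : lmodType R}.

Definition mink_add (A B : set Y) : set Y := [set a + b | a in A & b in B].

Definition mink_sub (A B : set Y) : set Y := [set a - b | a in A & b in B].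

Definition mink_scale (T : set R) (k : Y) : set Y := [set t *: k | t in T].

Definition translate (y : Y) (A : set Y) : set Y := [set y + a | a in A].

Definition proper_subset (A : set Y) : Prop := A !=set0 /\ A <> setT.

Definition alg_interior (A : set Y) : set Y :=
  [set a | forall y : Y, exists2 t : R, 0 < t &
     forall s : R, 0 <= s <= t -> A (a + s *: y)].

Definition linear_subspace (A : set Y) : Prop := submod_closed [in A].

End MinkowskiOperations.

Definition nneg_scalars {R : realType} : set R := [set t | 0 <= t].
Definition pos_scalars {R : realType} : set R := [set t | 0 < t].

Definition boundary {Y : topologicalType} (A : set Y) : set Y :=
  closure A `\` interior A.

(* Strict convexity is only used for closed sets. *)
Definition strictly_convex_set {R : realType} {Y : topologicalLmodType R}
    (A : set Y) : Prop :=
  forall (a1 a2 : Y) (l : R), A a1 -> A a2 -> a1 <> a2 -> 0 < l < 1 ->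
    interior A (l *: a1 + (1 - l) *: a2).

(* The values of our functions lie in option (\bar R), where None stands for
   the symbol nu, which is not comparable with any extended real. *)
Section NuValuedFunctions.
Context {R : realType} {Y : topologicalLmodType R}.
Implicit Type f : Y -> option (\bar R).

Definition inf_nu (S : set R) : option (\bar R) :=
  if `[< S = set0 >] then None else Some (ereal_inf (EFin @` S)).

Definition phi_fun (A : set Y) (k : Y) (y : Y) : option (\bar R) :=
  inf_nu [set t : R | translate (t *: k) A y].

Definition findom f : set Y := [set y | exists r : R, f y = Some r%:E].

Definition effdom f : set Y := [set y | findom f y \/ f y = Some -oo%E].

Definition lev f (rel : rel (\bar R)) (t : R) : set Y :=
  [set y | exists2 v : \bar R, f y = Some v & rel v t%:E].

Definition proper_fun f : Prop := effdom f !=set0 /\ effdom f `<=` findom f.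

Definition finite_valued f : Prop := forall y : Y, findom f y.

(* The value +oo is junk where f y = nu.  It is never used below: a function on
   a subspace topology is constrained only on that subspace, and strict
   quasiconvexity evaluates f only on its domain, which is convex. *)
Definition evalue f (y : Y) : \bar R := odflt +oo%E (f y).

Definition continuous_on_dom f : Prop :=
  {within effdom f, continuous (evalue f)}.

Definition strictly_quasiconvex f : Prop :=
  convex_set (effdom f : set (convex_lmodType Y)) /\
  forall (y1 y2 : Y) (l : R), effdom f y1 -> effdom f y2 ->
    y1 <> y2 -> 0 < l < 1 ->
    (evalue f (l *: y1 + (1 - l) *: y2)%R
       < Order.max (evalue f y1) (evalue f y2))%E.

Definition linear_functional f : Prop :=
  exists g : {scalar Y}, forall y : Y, f y = Some (g y)%:E.

End NuValuedFunctions.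

(* Main.v *)
Require Import Defs.
From HB Require Import structures.
From mathcomp Require Import all_boot all_order all_algebra.
From mathcomp Require Import all_classical all_reals all_analysis.

Import Order.TTheory GRing.Theory Num.Theory.
Import numFieldNormedType.Exports.

Local Open Scope classical_set_scope.
Local Open Scope ring_scope.

(** Write [phi] for [phi_fun A k]; its value at [y] is the infimum of the set
[S y] of the real numbers [t] with [y - t *: k] in [A].  Two facts about [S y]
carry the whole proof.  It is closed, because [A] is closed and the line
through [y] in direction [k] is continuous; and it is an up-set, because moving a point of [A] along [- k]
leads into the interior of [A].  So [S y] is empty, a closed half-line
or all of the real line, its infimum is attained whenever it is real, and
[phi] never takes the value [+oo].

This gives a dictionary: the value at [y] is at most [t] exactly when
[y - t *: k] lies in [A] ([phi_le]), less than [t] exactly when this point is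
in the interior ([phi_lt]), and equal to [t] exactly when it is on the boundary
([phi_eq]).  For [phi_lt], if [y - s *: k] is in [A] for some [s < t], the
hypothesis on [k] puts [y - t *: k] in the interior; conversely an interior
point can be moved a little along [+ k] without leaving [A], which yields an
admissible [s < t].

The rest is read off the dictionary.  Strict sublevel and superlevel sets are
translates of the open sets [interior A] and [~` A], whence continuity.
Properness says that no line in direction [k] meeting [A] is contained in [A],
that is, every such line crosses the boundary.  For strict quasiconvexity, both
points are translated by [t *: k], with [t] the larger of the two values, so
that they land in [A].  If the boundary is a linear subspace and [phi] is
real-valued, then [u - phi u *: k] is in the boundary for each [u], and linear
combinations of such relations give the linearity of [phi]. *)

(** * Minkowski sums with a line, as membership of shifted points *)

Section MinkowskiMembership.
Context {R : realType} {Y : lmodType R}.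
Implicit Types (A : set Y) (T : set R) (k y z : Y).

Lemma translateE y A z : translate y A z <-> A (z - y).
Proof.
split=> [[a Aa <-]|Az]; first by rewrite addrC addKr.
by exists (z - y) => //; rewrite addrC subrK.
Qed.

Lemma mink_add_lineE T k A y :
  mink_add (mink_scale T k) A y <-> exists2 t, T t & A (y - t *: k).
Proof.
split=> [[_ [t Tt <-] [a Aa <-]]|[t Tt At]].
  by exists t => //; rewrite addrC addKr.
by exists (t *: k); [exists t|exists (y - t *: k) => //; rewrite addrC subrK].
Qed.

Lemma mink_add_lineEr T k A y :
  mink_add A (mink_scale T k) y <-> exists2 t, T t & A (y - t *: k).
Proof.
split=> [[a Aa [_ [t Tt <-] <-]]|[t Tt At]]; first by exists t; rewrite ?addrK.
by exists (y - t *: k) => //; exists (t *: k); [exists t|rewrite subrK].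
Qed.

Lemma mink_sub_lineE T k A y :
  mink_sub A (mink_scale T k) y <-> exists2 t, T t & A (y + t *: k).
Proof.
split=> [[a Aa [_ [t Tt <-] <-]]|[t Tt At]]; first by exists t; rewrite ?subrK.
by exists (y + t *: k) => //; exists (t *: k); [exists t|rewrite addrK].
Qed.

End MinkowskiMembership.

(** * Lines and translations in a topological vector space *)

Section TopologicalModule.
Context {R : realType} {Y : topologicalLmodType R}.
Implicit Types (A : set Y) (y z : Y).

Lemma continuous_subr z : continuous (fun y => y - z).
Proof.
move=> y; apply: (@continuous2_cvg _ _ _ _ _ _ _ _ (fun a b : Y => a + b)).
- exact: (add_continuous (y, - z)).
- exact: cvg_id.
- exact: cvg_cst.
Qed.

Lemma continuous_ray y z : continuous (fun t : R => y + t *: z).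
Proof.
move=> t; apply: (@continuous2_cvg _ _ _ _ _ _ _ _ (fun a b : Y => a + b)).
- exact: (add_continuous (y, t *: z)).
- exact: cvg_cst.
- apply: (@continuous2_cvg _ _ _ _ _ _ _ _ (fun (a : R^o) (b : Y) => a *: b)).
  + exact: (scale_continuous (t : R^o, z)).
  + exact: cvg_id.
  + exact: cvg_cst.
Qed.

Lemma interior_sub_alg_interior A : interior A `<=` alg_interior A.
Proof.
move=> a Aa y; have : nbhs (0 : R) (fun s => A (a + s *: y)).
  by apply: (continuous_ray a y 0); rewrite scale0r addr0.
move/nbhs_ballP => [e /= e0 eA]; exists (e / 2); first by rewrite divr_gt0.
move=> s /andP[s0 se]; apply: eA; rewrite /ball /= sub0r normrN ger0_norm//.
by rewrite (le_lt_trans se)// ltr_pdivrMr// ltr_pMr// ltr1n.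
Qed.

End TopologicalModule.

(** * Functions with the value nu *)

Section NuValued.
Context {R : realType} {Y : topologicalLmodType R}.
Implicit Types (f : Y -> option (\bar R)) (y : Y) (t : R).

(** Reading nu as [+oo] keeps a level set unchanged as soon as the relation
excludes [+oo].  The next two lemmas similarly let all later arguments use
[evalue] in place of the option type. *)
Lemma lev_evalueE f (r : rel (\bar R)) t y :
  ~~ r +oo%E t%:E -> lev f r t y <-> r (evalue f y) t%:E.
Proof.
rewrite /evalue => rN; split=> [[v -> //]|].
by case E: (f y) => [v|] /= rv; [exists v|rewrite rv in rN].
Qed.

Lemma effdom_evalueE f y : effdom f y <-> (evalue f y < +oo)%E.
Proof.
rewrite /evalue; split=> [[[r ->]|->]|]; rewrite ?ltry//=.
by case E: (f y) => [[r| |]|] //= _; [left; exists r|right].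
Qed.

Lemma some_evalueE f y v : (v < +oo)%E -> f y = Some v <-> evalue f y = v.
Proof.
rewrite /evalue => vy; split=> [->//|].
by case E: (f y) => [u|] /= uv; [rewrite uv|rewrite -uv ltxx in vy].
Qed.

End NuValued.

(** A closed up-set contains its infimum if this is real, and every real number
if it is [-oo], so in both cases [t] is in the set as soon as [inf <= t].  For
the empty set, [+oo] stands for nu and no [t] qualifies on either side. *)
Lemma inf_nu_le (R : realType) (S : set R) (t : R) :
  (forall s u, s <= u -> S s -> S u) -> closed S ->
  (odflt +oo (inf_nu S) <= t%:E)%E <-> S t.
Proof.
move=> Sup Scl; rewrite /inf_nu; case: asboolP => [->|S0] /=.
  by rewrite leye_eq.
split=> [St|St]; last by apply: ereal_inf_lbound; exists t.
(* [t] is in the closure of [S], since each [t + e / 2] is in [S]. *)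
apply: Scl => B /nbhs_ballP[e /= e0 eB]; exists (t + e / 2); split.
  have : (ereal_inf (EFin @` S) < (t + e / 2)%:E)%E.
    by rewrite (le_lt_trans St)// lte_fin ltrDl divr_gt0.
  by move=> /ereal_inf_lt[_ [s Ss <-]]; rewrite lte_fin => /ltW /Sup; exact.
apply: eB; rewrite /ball /= opprD addNKr normrN gtr0_norm ?divr_gt0//.
by rewrite ltr_pdivrMr// ltr_pMr// ltr1n.
Qed.

(** * Sets absorbing a ray in their interior *)

Section ScalarizingFunction.
Set Implicit Arguments.
Unset Strict Implicit.
Context {R : realType} {Y : topologicalLmodType R}.
Variables (A : set Y) (k : Y).
Hypothesis A_closed : closed A.
Hypothesis A_k : mink_sub A (mink_scale pos_scalars k) `<=` interior A.

Let phi := phi_fun A k.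

Lemma shiftB y s t : y - (t - s) *: k = y - t *: k + s *: k.
Proof. by rewrite scalerBl opprB [s *: k - _]addrC addrA. Qed.

Lemma interior_subray a t : A a -> 0 < t -> interior A (a - t *: k).
Proof. by move=> Aa t0; apply: A_k; exists a => //; exists (t *: k) => //; exists t. Qed.

(** The set of admissible [t] is an up-set, with an interior point strictly
above every admissible one. *)
Lemma interior_shift_lt y s t :
  s < t -> A (y - s *: k) -> interior A (y - t *: k).
Proof.
move=> st /interior_subray; rewrite -subr_gt0 in st => /(_ _ st).
by rewrite -addrA -opprD -scalerDl [s + _]addrC subrK.
Qed.

Lemma shift_le y s t : s <= t -> A (y - s *: k) -> A (y - t *: k).
Proof.
rewrite le_eqVlt => /predU1P[->//|st As].
by apply: interior_subset; exact: interior_shift_lt As.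
Qed.

(** A point [a] of [A] is the limit of the interior points [a - t *: k] as [t]
tends to 0 from above. *)
Lemma closure_interior_ray : A = closure (interior A).
Proof.
apply/seteqP; split=> [a Aa B|a Ca]; last first.
  by rewrite ((closure_id A).1 A_closed); exact: (closureS (@interior_subset _ A)).
have cont := @continuous_ray _ _ a (- k) 0.
rewrite -[a in nbhs a]addr0 -(scale0r (- k)) => /cont/nbhs_ballP[e /= e0 eB].
exists (a - (e / 2) *: k); split; first by apply: interior_subray; rewrite ?divr_gt0.
rewrite -scalerN; apply: eB; rewrite /ball /= sub0r normrN gtr0_norm ?divr_gt0//.
by rewrite ltr_pdivrMr// ltr_pMr// ltr1n.
Qed.

(** A point [a] of the core satisfies [A (a + t *: k)] for some [t > 0], and
moving back by [t *: k] leads into the interior. *)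
Lemma alg_interior_ray : alg_interior A = interior A.
Proof.
apply/seteqP; split; last exact: interior_sub_alg_interior.
move=> a /(_ k)[t t0 /(_ t)]; rewrite lexx (ltW t0) => /(_ isT).
by move=> /interior_subray/(_ t0); rewrite addrK.
Qed.

(** * The dictionary between values and shifted points *)

Lemma closed_shifts y : closed [set t | A (y - t *: k)].
Proof.
have -> : [set t | A (y - t *: k)] = (fun t => y + t *: (- k)) @^-1` A.
  by apply/seteqP; split=> t /=; rewrite scalerN.
by move/continuous_closedP: (continuous_ray y (- k)); exact.
Qed.

Lemma phi_le y t : (evalue phi y <= t%:E)%E <-> A (y - t *: k).
Proof.
rewrite /evalue /phi /phi_fun.
have -> : [set s | translate (s *: k) A y] = [set s | A (y - s *: k)].
  by apply/seteqP; split=> s /translateE.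
apply: (@inf_nu_le _ [set s | A (y - s *: k)]).
- by move=> s u; exact: shift_le.
- exact: closed_shifts.
Qed.

(** A value below [t] leaves room for an admissible real [s < t], also when the
value is [-oo]; conversely an interior point stays in [A] when moved slightly
along [k]. *)
Lemma phi_lt y t : (evalue phi y < t%:E)%E <-> interior A (y - t *: k).
Proof.
split=> [yt|/interior_sub_alg_interior/(_ k)[e e0 /(_ e)]].
  have [s st ys] : exists2 s, s < t & (evalue phi y <= s%:E)%E.
    case: (evalue phi y) yt => [r| |] //=; first by rewrite lte_fin; exists r.
    by exists (t - 1); rewrite ?leNye// gtrDl oppr_lt0.
  exact/(interior_shift_lt st)/phi_le.
rewrite lexx (ltW e0) => /(_ isT) Ae.
have : A (y - (t - e) *: k) by rewrite shiftB.
by move/phi_le/le_lt_trans; apply; rewrite lte_fin gtrDl oppr_lt0.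
Qed.

Lemma phi_eq y t : evalue phi y = t%:E <-> boundary A (y - t *: k).
Proof.
rewrite /boundary -((closure_id A).1 A_closed).
split=> [yt|[/phi_le yt /phi_lt/negP]].
  by split; [apply/phi_le; rewrite yt|move/phi_lt; rewrite yt ltxx].
by rewrite -leNgt => ty; apply/eqP; rewrite eq_le yt ty.
Qed.

Lemma phi_lty y : (evalue phi y < +oo)%E <-> exists t, A (y - t *: k).
Proof.
split=> [yt|[t /phi_le/le_lt_trans]]; last by apply; rewrite ltry.
have At t : (evalue phi y <= t%:E)%E -> exists t, A (y - t *: k).
  by move/phi_le; exists t.
by case: (evalue phi y) yt At => [r| |] // _ At;
  [exact: (At r)|exact: (At 0 (leNye _))].
Qed.

Lemma effdom_phi y : effdom phi y <-> exists t, A (y - t *: k).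
Proof. by rewrite effdom_evalueE phi_lty. Qed.

Lemma phi_ninfty y : evalue phi y = -oo%E <-> forall t, A (y - t *: k).
Proof.
split=> [y_oo t|Ay]; first by apply/phi_le; rewrite y_oo leNye.
by apply: eq_ninfty => t; apply/phi_le.
Qed.

Lemma findom_phi y : findom phi y <-> exists t, boundary A (y - t *: k).
Proof.
by split=> -[t yt]; exists t; [apply/phi_eq; rewrite /evalue yt|
  apply/some_evalueE; [exact: ltry|exact/phi_eq]].
Qed.

Lemma effdom_phi_interior y : effdom phi y <-> exists t, interior A (y - t *: k).
Proof.
rewrite effdom_phi; split=> -[t At]; last by exists t; exact: interior_subset.
by exists (t + 1); apply: (interior_shift_lt _ At); rewrite ltrDl.
Qed.

Lemma effdom_phiE : effdom phi = mink_add (mink_scale setT k) A.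
Proof.
apply/seteqP; split=> y; rewrite effdom_phi mink_add_lineE.
  by move=> [t]; exists t.
by move=> [t _]; exists t.
Qed.

Lemma effdom_phi_interiorE :
  effdom phi = mink_add (mink_scale setT k) (interior A).
Proof.
apply/seteqP; split=> y; rewrite effdom_phi_interior mink_add_lineE.
  by move=> [t]; exists t.
by move=> [t _]; exists t.
Qed.

Lemma lev_phi_le t : lev phi <=%O t = translate (t *: k) A.
Proof. by apply/seteqP; split=> y; rewrite lev_evalueE// translateE phi_le. Qed.

Lemma lev_phi_lt t : lev phi <%O t = translate (t *: k) (interior A).
Proof. by apply/seteqP; split=> y; rewrite lev_evalueE// translateE phi_lt. Qed.

Lemma lev_phi_eq t : lev phi eq_op t = translate (t *: k) (boundary A).
Proof.
apply/seteqP; split=> y; rewrite lev_evalueE// translateE -phi_eq.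
  by move/eqP.
by move=> ->.
Qed.

(** * Continuity *)

Lemma open_phi_lt t : open [set y | (evalue phi y < t%:E)%E].
Proof.
have -> : [set y | (evalue phi y < t%:E)%E] = (fun y => y - t *: k) @^-1` interior A.
  by apply/seteqP; split=> y /phi_lt.
by apply: open_comp; [move=> y _; exact: continuous_subr|exact: open_interior].
Qed.

(** With nu read as [+oo], the strict superlevel set also contains the points
outside the domain, which makes it the complement of a translate of [A]. *)
Lemma open_phi_gt t : open [set y | (t%:E < evalue phi y)%E].
Proof.
have -> : [set y | (t%:E < evalue phi y)%E] = (fun y => y - t *: k) @^-1` (~` A).
  apply/seteqP; split=> y /=; rewrite ltNge; first by move=> /negP ty /phi_le.
  by move=> Ay; apply/negP => /phi_le.
by apply: open_comp; [move=> y _; exact: continuous_subr|exact: closed_openC].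
Qed.

Lemma open_effdom : open (effdom phi).
Proof.
have -> : effdom phi = \bigcup_t [set y | (evalue phi y < t%:E)%E].
  apply/seteqP; split=> y; first by move=> /effdom_phi_interior[t /phi_lt]; exists t.
  by move=> [t _ /phi_lt At]; apply/effdom_phi_interior; exists t.
by apply: bigcup_open => t _; exact: open_phi_lt.
Qed.

(** The strict sublevel and superlevel sets are open in the whole space, so
[evalue phi] is continuous at each point of the domain, which is more than
continuity of the restriction. *)
Lemma phi_continuous_on_dom : continuous_on_dom phi.
Proof.
apply: continuous_in_subspaceT => y /set_mem /effdom_evalueE yoo.
have near_lt t : (evalue phi y < t%:E)%E -> \forall z \near y, (evalue phi z < t%:E)%E.
  by move=> yt; exact: (open_nbhs_nbhs (conj (open_phi_lt t) yt)).
have near_gt t : (t%:E < evalue phi y)%E -> \forall z \near y, (t%:E < evalue phi z)%E.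
  by move=> yt; exact: (open_nbhs_nbhs (conj (open_phi_gt t) yt)).
move=> B; rewrite /nbhs /= /ereal_nbhs /=.
case E: (evalue phi y) yoo near_lt near_gt => [r| |] //= _ near_lt near_gt.
  move=> /nbhs_ballP[e /= e0 eB]; near=> z.
  have : (evalue phi z < (r + e)%:E)%E.
    by near: z; apply: near_lt; rewrite lte_fin ltrDl.
  have : ((r - e)%:E < evalue phi z)%E.
    by near: z; apply: near_gt; rewrite lte_fin gtrDl oppr_lt0.
  rewrite /=; case: (evalue phi z) => [s| |] //; rewrite !lte_fin => rs sr.
  by apply: eB; rewrite /ball /= ltr_distlC rs sr.
by move=> [M [_ MB]]; apply: filterS (near_lt M (ltNyr M)) => z; exact: MB.
Unshelve. all: by end_near.
Qed.

(** * Points of finite value and properness *)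

Lemma findom_boundary : findom phi = mink_add (boundary A) (mink_scale setT k).
Proof.
apply/seteqP; split=> y.
  by move=> /findom_phi[t]; rewrite mink_add_lineEr; exists t.
by move=> /mink_add_lineEr[t _ At]; apply/findom_phi; exists t.
Qed.

Lemma boundary_sub : boundary A `<=` A.
Proof. by move=> a []; rewrite -((closure_id A).1 A_closed). Qed.

Lemma phi_lt0 y : interior A y <-> (evalue phi y < 0%:E)%E.
Proof. by rewrite phi_lt scale0r subr0. Qed.

Lemma phi_eq0 y : boundary A y <-> evalue phi y = 0%:E.
Proof. by rewrite phi_eq scale0r subr0. Qed.

Lemma phi_le0 y : A y <-> (evalue phi y <= 0%:E)%E.
Proof. by rewrite phi_le scale0r subr0. Qed.

(** Outside [interior A] the value is nonnegative, hence real on the domain, and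
it is the parameter of the boundary point. *)
Lemma effdomD_interior :
  effdom phi `\` interior A `<=` mink_add (boundary A) (mink_scale nneg_scalars k).
Proof.
move=> y [/effdom_evalueE yoo /phi_lt0/negP]; rewrite -leNgt.
case E: (evalue phi y) yoo => [t| |] // _; rewrite lee_fin => t0.
by apply/mink_add_lineEr; exists t => //; apply/phi_eq.
Qed.

(** An interior point [y] has a negative value [t], real by properness, and
[y - t *: k] is then a boundary point, reached from [y] in direction [+ k]. *)
Lemma proper_interior : proper_fun phi ->
  interior A = mink_sub (boundary A) (mink_scale pos_scalars k).
Proof.
move=> [_ dom_fin]; apply/seteqP; split=> y.
  move=> /phi_lt0 y0; have /findom_phi[t At] : findom phi y.
    by apply/dom_fin/effdom_evalueE; rewrite (lt_trans y0)// ltry.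
  apply/mink_sub_lineE; exists (- t); last by rewrite scaleNr.
  by move/phi_eq: At y0 => ->; rewrite lte_fin /pos_scalars /= oppr_gt0.
move=> /mink_sub_lineE[t t0 /boundary_sub/interior_subray/(_ t0)].
by rewrite addrK.
Qed.

Lemma interior_boundary_ray :
  interior A = mink_sub (boundary A) (mink_scale pos_scalars k) ->
  A = mink_sub (boundary A) (mink_scale nneg_scalars k).
Proof.
move=> intA; apply/seteqP; split=> y.
  move=> Ay; apply/mink_sub_lineE; have [iy|niy] := pselect (interior A y).
    by move: iy; rewrite {1}intA => /mink_sub_lineE[t /ltW]; exists t.
  exists 0; first exact: lexx.
  by rewrite scale0r addr0; split=> //; exact: subset_closure.
move=> /mink_sub_lineE[t t0 /boundary_sub]; rewrite -[_ + _]subr0 -(scale0r k).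
by move=> /(shift_le t0); rewrite addrK.
Qed.

(** Each point of [A] lies on a line in direction [k] through a boundary
point, and the domain is the union of the lines in direction [k] meeting [A]. *)
Lemma boundary_ray_dom :
  A = mink_sub (boundary A) (mink_scale nneg_scalars k) ->
  effdom phi = mink_add (boundary A) (mink_scale setT k).
Proof.
move=> A_eq; apply/seteqP; split=> y.
  move=> /effdom_phi[t]; rewrite {1}A_eq => /mink_sub_lineE[s _ As].
  apply/mink_add_lineEr; exists (t - s) => //.
  by rewrite shiftB.
move=> /mink_add_lineEr[t _ /boundary_sub At]; apply/effdom_phi.
by exists t.
Qed.

Lemma effdom_nonempty : A !=set0 -> effdom phi !=set0.
Proof. by move=> [a Aa]; exists a; apply/effdom_phi; exists 0; rewrite scale0r subr0. Qed.

Lemma proper_phiP : A !=set0 ->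
    [<-> proper_fun phi;
         interior A = mink_sub (boundary A) (mink_scale pos_scalars k);
         A = mink_sub (boundary A) (mink_scale nneg_scalars k);
         effdom phi = mink_add (boundary A) (mink_scale setT k)].
Proof.
move=> A0; tfae; [exact: proper_interior|exact: interior_boundary_ray|
  exact: boundary_ray_dom|].
by move=> domE; split; [exact: effdom_nonempty|rewrite domE findom_boundary].
Qed.

Lemma finite_valuedP :
  finite_valued phi <-> [set: Y] = mink_add (boundary A) (mink_scale setT k).
Proof.
rewrite -findom_boundary; split=> [fin|finE y]; last by rewrite -finE.
by apply/seteqP; split.
Qed.

(** If all the shifts of [y] lie in [A], each of them lies in the interior,
because another shift is further along [+ k]. *)
Lemma phi_ninftyP y :
  phi y = Some -oo%E <-> translate y (mink_scale setT k) `<=` interior A.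
Proof.
rewrite some_evalueE// phi_ninfty; split=> [Ay _ [_ [t _ <-] <-]|Ay t].
  have : interior A (y - (- t) *: k).
    by apply: interior_shift_lt (Ay (- t - 1)); rewrite gtrDl oppr_lt0.
  by rewrite scaleNr opprK.
apply: interior_subset; apply: Ay; exists (- t *: k); last by rewrite scaleNr.
by exists (- t).
Qed.

(** * Strict quasiconvexity *)

(** Both points of [A] have value at most 0, so the value of a strict convex
combination is negative. *)
Lemma quasiconvex_strictly_convex :
  strictly_quasiconvex phi -> strictly_convex_set A.
Proof.
move=> [_ qc] a1 a2 l A1 A2 a12 l01; apply/phi_lt0.
have domA a : A a -> effdom phi a.
  by move=> Aa; apply/effdom_phi; exists 0; rewrite scale0r subr0.
apply: lt_le_trans (qc _ _ _ (domA _ A1) (domA _ A2) a12 l01) _.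
by rewrite ge_max; apply/andP; split; apply/phi_le0.
Qed.

(** With [t] the larger of the two values, both points shifted by [t *: k] lie
in [A] and remain distinct, so their combination is interior.  A common real
[t] exists because no value is [-oo]; this is where properness enters.
Convexity of the domain follows, since the combination has a value below
[+oo]. *)
Lemma strictly_convex_quasiconvex : effdom phi `<=` findom phi ->
  strictly_convex_set A -> strictly_quasiconvex phi.
Proof.
move=> dom_fin Acvx.
have qc y1 y2 l : effdom phi y1 -> effdom phi y2 -> y1 <> y2 -> 0 < l < 1 ->
    (evalue phi (l *: y1 + (1 - l) *: y2)%R
       < Order.max (evalue phi y1) (evalue phi y2))%E.
  move=> /dom_fin[t1 /some_evalueE-/(_ (ltry _)) E1].
  move=> /dom_fin[t2 /some_evalueE-/(_ (ltry _)) E2] y12 l01.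
  rewrite E1 E2 -EFin_max; set t := Num.max t1 t2; apply/phi_lt.
  have -> : l *: y1 + (1 - l) *: y2 - t *: k =
            l *: (y1 - t *: k) + (1 - l) *: (y2 - t *: k).
    rewrite !scalerBr addrACA -opprD -scalerDl.
    by rewrite [l + _]addrC subrK scale1r.
  apply: Acvx => //; last by move=> /addIr.
  - by apply/phi_le; rewrite E1 lee_fin le_max lexx.
  - by apply/phi_le; rewrite E2 lee_fin le_max lexx orbT.
split=> //; apply/convex_setW => y1 y2 /set_mem d1 /set_mem d2 l l0 l1.
apply/mem_set; have [<-|/eqP y12] := eqVneq y1 y2; first by rewrite convmm.
apply/effdom_evalueE/(lt_le_trans (qc _ _ _ d1 d2 y12 _)); first by rewrite l0 l1.
by rewrite leey.
Qed.

(** * Linearity *)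

(** The boundary is the zero level set, here the kernel of a linear form. *)
Lemma linear_phi_boundary : linear_functional phi -> linear_subspace (boundary A).
Proof.
move=> [g phi_g].
have bdE y : (y \in [in boundary A]) = (g y == 0).
  apply/idP/eqP => [/set_mem|gy0].
    by move=> /phi_eq0; rewrite /evalue phi_g => -[].
  by apply/mem_set/phi_eq0; rewrite /evalue phi_g gy0.
split=> [|a u v]; first by rewrite bdE linear0.
by rewrite !bdE linearP => /eqP -> /eqP ->; rewrite mulr0 addr0.
Qed.

(** The value [g y] is the unique [t] for which [y - t *: k] is in the boundary.
So the boundary is a complement of the line spanned by [k], and [g] is
the coordinate along [k]. *)
Lemma boundary_linear_phi : finite_valued phi ->
  linear_subspace (boundary A) -> linear_functional phi.
Proof.
move=> fin [bd0 bdP]; pose g y := fine (evalue phi y).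
have phi_g y : phi y = Some (g y)%:E.
  by have [r yr] := fin y; rewrite /g /evalue yr.
have gP y t : g y = t <-> boundary A (y - t *: k).
  by rewrite -phi_eq /evalue phi_g /=; split=> [->//|[]].
have g_lin : scalar g.
  move=> a u v; apply/gP.
  have -> : a *: u + v - (a * g u + g v) *: k =
            a *: (u - g u *: k) + (v - g v *: k).
    by rewrite scalerBr scalerA addrACA -opprD -scalerDl.
  by apply/set_mem/bdP; apply/mem_set; apply/gP.
pose G : {scalar Y} := HB.pack g (GRing.isLinear.Build _ _ _ _ g g_lin).
by exists G.
Qed.

End ScalarizingFunction.

(** * Topological and algebraic properties of the scalarizing function *)

Theorem theorem4 (R : realType) (Y : topologicalLmodType R) (A : set Y) (k : Y)
    (A_closed : closed A) (A_proper : proper_subset A) (k_neq0 : k <> 0)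
    (A_k : mink_sub A (mink_scale pos_scalars k) `<=` interior A) :
  let f := phi_fun A k in
  [/\ A = closure (interior A),
      alg_interior A = interior A,
      continuous_on_dom f,
      [/\ effdom f = mink_add (mink_scale setT k) A,
          effdom f = mink_add (mink_scale setT k) (interior A),
          effdom f !=set0 & open (effdom f)] &
      forall t : R,
        [/\ lev f <=%O t = translate (t *: k) A,
            lev f <%O t = translate (t *: k) (interior A) &
            lev f eq_op t = translate (t *: k) (boundary A)]]
  /\ [/\
    (* (a) *)
    forall y : Y,
      f y = Some -oo%E <-> translate y (mink_scale setT k) `<=` interior A,
    (* (b) *)
    findom f = mink_add (boundary A) (mink_scale setT k) /\
    effdom f `\` interior A `<=` mink_add (boundary A) (mink_scale nneg_scalars k),
    (* (c) *)
    [<-> proper_fun f;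
         interior A = mink_sub (boundary A) (mink_scale pos_scalars k);
         A = mink_sub (boundary A) (mink_scale nneg_scalars k);
         effdom f = mink_add (boundary A) (mink_scale setT k)],
    (* (d) *)
    finite_valued f <-> [set: Y] = mink_add (boundary A) (mink_scale setT k) &
    (* (e), (f) *)
    (proper_fun f -> (strictly_quasiconvex f <-> strictly_convex_set A)) /\
    (finite_valued f -> (linear_functional f <-> linear_subspace (boundary A)))].
Proof.
move=> f; have [A0 _] := A_proper; split; split.
- exact: closure_interior_ray A_closed A_k.
- exact: alg_interior_ray A_k.
- exact: phi_continuous_on_dom.
- split; [exact: effdom_phiE|exact: effdom_phi_interiorE|
    exact: effdom_nonempty|exact: open_effdom].
- by move=> t; split; [exact: lev_phi_le|exact: lev_phi_lt|exact: lev_phi_eq].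
- exact: phi_ninftyP.
- by split; [exact: findom_boundary|exact: effdomD_interior].
- exact: proper_phiP.
- exact: finite_valuedP.
- split=> [[_ dom_fin]|fin]; split.
  + exact: quasiconvex_strictly_convex.
  + exact: strictly_convex_quasiconvex.
  + exact: linear_phi_boundary.
  + exact: boundary_linear_phi.
Qed.
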